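(* Let $L$ be a non-contractible compact metric ANR and let $X$ and $Y$ be non-empty compact spaces. Then $$L\text{-}\dim Z(X,Y)=\max\{L\text{-}\dim X,\;L\text{-}\dim Y\}.$$
   Context: All spaces are $T_1$ and completely regular (so compact spaces are Hausdorff); maps are continuous; $\mathbb N$ contains $0$. $L$ is a non-empty compact metric ANR. $L\text{-}\dim$. $L^{*m}$ is the join $L*\cdots*L$ of $m$ copies of $L$. For normal $X$: $L\text{-}\dim X=-1$ iff $X=\emptyset$; for $n\in\mathbb N$, $L\text{-}\dim X\le n$ iff every map $f\colon F\to L^{*(n+1)}$ from a closed subspace $F\subset X$ extends to a map $X\to L^{*(n+1)}$; for $X\ne\emptyset$, $L\text{-}\dim X=\min\{n\in\mathbb N: L\text{-}\dim X\le n\}$, where $\min\emptyset=\infty$. The space $Z(X,Y)$ for non-empty compact $X,Y$. $A_{\mathfrak m}$ is the one-point compactification of the discrete space of cardinality $\mathfrak m$, and $\mu$ is its unique non-isolated point. $\mathcal S_X$ is the family of all subsets of $X$ that are finite (possibly empty) or homeomorphic to $A_{\aleph_0}$. Fix a cardinal $\mathfrak m\ge\max\{\aleph_0,(wX)^+,(wY)^+,\mathrm{card}\,\mathcal S_X\}$ ($w$ = weight) and a function $\varphi\colon A_{\mathfrak m}\setminus\{\mu\}\to\mathcal S_X$ with $\mathrm{card}\,\varphi^{-1}(S)=\mathfrak m$ for every $S\in\mathcal S_X$. Let $\pi_1\colon A_{\mathfrak m}\times X\times Y\to N$ be the quotient map collapsing each set $\{\mu\}\times\{x\}\times Y$, $x\in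 X$, to a point. Put $H(\mu)=\pi_1(\{\mu\}\times X\times Y)$, $H(\alpha)=\pi_1(\{\alpha\}\times\varphi(\alpha)\times Y)$ for $\alpha\ne\mu$, and $Z(X,Y)=\bigcup_{\alpha\in A_{\mathfrak m}}H(\alpha)\subset N$. The choices of $\mathfrak m$ and $\varphi$ are arbitrary. *)

(* Defs.v *)
From HB Require Import structures.
From mathcomp Require Import all_boot all_order all_algebra generic_quotient.
From mathcomp Require Import all_classical all_reals all_analysis.

Set Implicit Arguments.
Unset Strict Implicit.
Unset Printing Implicit Defensive.

Import Order.TTheory GRing.Theory Num.Theory.
Import numFieldNormedType.Exports.

Local Open Scope classical_set_scope.
Local Open Scope ring_scope.
Local Open Scope card_scope.
Local Open Scope quotient_scope.

Definition homeomorphic (T U : topologicalType) : Prop :=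
  exists (f : T -> U) (g : U -> T),
    [/\ continuous f, continuous g, cancel f g & cancel g f].

Definition unit_interval (R : realType) : topologicalType :=
  set_type (`[0, 1] : set R).

Definition contractible (R : realType) (T : topologicalType) : Prop :=
  exists (h : T * unit_interval R -> T) (c : T),
    [/\ continuous h,
        forall x t, val t = 0 -> h (x, t) = x
      & forall x t, val t = 1 -> h (x, t) = c].

Definition neighborhood_retract (M : topologicalType) (A : set M) : Prop :=
  exists (U : set M) (r : M -> M),
    [/\ open U, A `<=` U, {within U, continuous r}, r @` U `<=` A
      & forall a, A a -> r a = a].

(* Absolute neighborhood retract, for the class of metrizable spaces. *)
Definition ANR (R : realType) (L : topologicalType) : Prop :=
  forall (M : metricType R) (A : set M),
    closed A -> homeomorphic L (set_type A) -> neighborhood_retract A.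

Section Join.
Context {R : realType} {X Y : topologicalType}.

Let P : topologicalType := (X * Y * unit_interval R)%type.

Definition join_rel (p q : P) : bool :=
  `[< p = q \/
      [/\ val p.2 = 0, val q.2 = 0 & p.1.1 = q.1.1] \/
      [/\ val p.2 = 1, val q.2 = 1 & p.1.2 = q.1.2] >].

Let join_rel_refl : reflexive join_rel.
Proof. by move=> p; apply/asboolP; left. Qed.

Let join_rel_sym : symmetric join_rel.
Proof.
by move=> p q; apply/asboolP/asboolP;
  move=> [->|[[? ? ?]|[? ? ?]]]; [left|right; left|right; right|
                                  left|right; left|right; right].
Qed.

Let join_rel_trans : transitive join_rel.
Proof.
move=> q p r /asboolP + /asboolP.
move=> [->|[[p0 q0 pq]|[p1 q1 pq]]] => [[->|[[q0' r0 qr]|[q1' r1 qr]]]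
   |[<-|[[q0' r0 qr]|[q1' r1 qr]]]|[<-|[[q0' r0 qr]|[q1' r1 qr]]]];
  apply/asboolP; try by [left|right; left|right; right].
- by right; left; rewrite pq.
- by move: q1'; rewrite q0 => /eqP; rewrite eq_sym oner_eq0.
- by move: q1; rewrite q0' => /eqP; rewrite eq_sym oner_eq0.
- by right; right; rewrite pq.
Qed.

Definition join_equiv := EquivRel _ join_rel_refl join_rel_sym join_rel_trans.

End Join.

(* For non-empty [X] and [Y]; the convention that the join of [X] with the
   empty space is [X] is not built in. *)
Definition join (R : realType) (X Y : topologicalType) : topologicalType :=
  quotient_topology {eq_quot @join_equiv R X Y}.

(* [join_powS R L n] is the join of [n.+1] copies of [L]. *)
Fixpoint join_powS (R : realType) (L : topologicalType) (n : nat) :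
    topologicalType :=
  if n is k.+1 then join R (join_powS R L k) L else L.

Section Ldim.
Context (R : realType) (L X : topologicalType).

Definition Ldim_le (n : nat) : Prop :=
  forall (F : set X) (f : set_type F -> join_powS R L n),
    closed F -> continuous f ->
    exists2 g : X -> join_powS R L n,
      continuous g & forall x : set_type F, g (val x) = f x.

(* The value is meant only for normal [X]; [+oo] is the minimum of the empty set. *)
Definition Ldim : \bar int :=
  if pselect ([set: X] = set0) then (-1)%:E
  else if pselect (exists n, `[< Ldim_le n >]) is left ex
  then ((ex_minn ex)%:Z)%:E
  else +oo%E.

End Ldim.

(* A cardinal [m] is given by a type [D] of cardinality [m]. *)
Definition A_ (D : choiceType) : topologicalType :=
  one_point_compactification (discrete_topology D).

Definition mu {D : choiceType} : A_ D := None.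

Definition fin_or_seq (X : topologicalType) : set (set X) :=
  [set S | finite_set S \/ homeomorphic (set_type S) (A_ nat)].

Arguments fin_or_seq X : clear implicits.

(* For cardinals, [a^+ <= b] if and only if [a < b]. *)
Definition card_succ_le {T U} (A : set T) (B : set U) : Prop :=
  A #<= B /\ ~ (B #<= A).

(* A base of cardinality equal to the weight. *)
Definition weight_base (X : topologicalType) (B : set (set X)) : Prop :=
  basis B /\ forall B' : set (set X), basis B' -> B #<= B'.

Definition weight_succ_le (X : topologicalType) {U} (C : set U) : Prop :=
  exists2 B : set (set X), weight_base B & card_succ_le B C.

Arguments weight_succ_le X {U} C.

Section ZSpace.
Context {X : topologicalType} (Y : topologicalType) {D : choiceType}.

Let P : topologicalType := (A_ D * X * Y)%type.

Definition collapse_rel (p q : P) : bool :=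
  `[< p = q \/ [/\ p.1.1 = mu, q.1.1 = mu & p.1.2 = q.1.2] >].

Let collapse_rel_refl : reflexive collapse_rel.
Proof. by move=> p; apply/asboolP; left. Qed.

Let collapse_rel_sym : symmetric collapse_rel.
Proof.
by move=> p q; apply/asboolP/asboolP => -[->|[? ? ?]]; [left|right|left|right].
Qed.

Let collapse_rel_trans : transitive collapse_rel.
Proof.
move=> q p r /asboolP + /asboolP.
move=> [->|[pm qm pq]] => [[->|[qm rm qr]]|[<-|[qm' rm qr]]];
  apply/asboolP; try by [left|right].
by right; rewrite pq.
Qed.

Definition collapse_equiv :=
  EquivRel _ collapse_rel_refl collapse_rel_sym collapse_rel_trans.

Definition quotN : topologicalType := quotient_topology {eq_quot collapse_equiv}.

Definition pi1 (p : P) : quotN := \pi_{eq_quot collapse_equiv} p.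

Variable phi : D -> set X.

Definition Hset (a : A_ D) : set quotN :=
  let S := if a is Some d then phi d else [set: X] in
  pi1 @` ([set a] `*` S `*` [set: Y]).

Definition Zspace : topologicalType := set_type (\bigcup_(a in [set: A_ D]) Hset a).

End ZSpace.

(* Main.v *)
From HB Require Import structures.
Require Import Defs.
From mathcomp Require Import all_boot all_order all_algebra generic_quotient.
From mathcomp Require Import all_classical all_reals all_analysis.
From mathcomp Require Import lra.

(** Write [K n] for the join of [n.+1] copies of [L], so that the L-dimension
of a space is at most [n] when [K n] is an absolute extensor for it. The
equality follows once it is known, for each [n], that

  (1) [K n] is an absolute extensor for Z(X, Y) if and only if it is one for
      [X] and for [Y] ([nbhd_ext_Zspace]);
  (2) if [K n] is an absolute extensor for a compact Hausdorff space, so is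
      [K n.+1] ([nbhd_ext_join_powS_mono]),

because (2) makes the least [n] with both properties the larger of the two
least ones.

In (1), necessity holds because the extension property passes to closed
subspaces: [X] is embedded in Z(X, Y) as the collapsed level over [mu], and [Y]
as a slice over any [d] with [phi d] non-empty. For sufficiency, Z(X, Y) is
mapped continuously to the one-point compactification [A_ D]. A map from a
closed set is first extended over the fibre over [mu], a copy of [X], then to a
neighborhood of it. By compactness this neighborhood contains all the fibres
over a neighborhood of [mu]; all other fibres are open, so the extension can be
chosen on each of them separately ([ext_on_fibres]). The fibre over [d] is [phi
d] times [Y], and the same argument reduces it to copies of [Y]: a finite set
or a convergent sequence maps injectively to the one-point compactification of
the natural numbers.

The argument needs [K n] to be a neighborhood extensor for compact Hausdorff
spaces. For [L] this is derived from the metric definition of an ANR by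
embedding [L] in the space of real functions on [L] with a uniform metric; a
map [f : F -> L] becomes the real function sending [(z, l)] to the distance
from [f z] to [l], capped at 1, which Tietze's theorem extends to [Z * L]
([ANR_nbhd_ext]). The passage to joins and statement (2) are the same
construction, carried out once with a boolean parameter ([nbhd_ext_join]): a
map from [F] to the join of [K] and [L] is a time [t : F -> [0, 1]] with a map
to [K] defined where [t < 1] and a map to [L] defined where [t > 0]. The two
maps are extended over open sets, and then [t] is extended in such a way that
it equals 1, resp. 0, wherever the extension to [K], resp. [L], is missing. As
the domains of the partial maps are not closed, they are exhausted by closed
sets ([nbhd_ext_sigma]). *)

Set Implicit Arguments.
Unset Strict Implicit.
Unset Printing Implicit Defensive.

Import Order.TTheory GRing.Theory Num.Theory.
Import numFieldNormedType.Exports.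

Local Open Scope classical_set_scope.
Local Open Scope ring_scope.
Local Open Scope card_scope.
Local Open Scope quotient_scope.

(** * Continuity on subsets, compactness and separation *)

Section Within.
Context {T U : topologicalType}.
Implicit Types (A : set T) (f g : T -> U).

Lemma within_openP A f : open A ->
  {within A, continuous f} <-> forall x, A x -> {for x, continuous f}.
Proof.
by move=> oA; rewrite continuous_open_subspace// in_setP.
Qed.

Lemma within_closedP A f : closed A ->
  {within A, continuous f} <->
  forall C, closed C -> closed (A `&` f @^-1` C).
Proof.
move=> cA; rewrite continuous_closedP.
by split=> H C /H; rewrite -[closed (_ @^-1` _)]closed_setSI.
Qed.

Lemma within_eq A f g : (forall x, A x -> f x = g x) ->
  {within A, continuous f} -> {within A, continuous g}.
Proof.
by move=> fg; apply: subspace_eq_continuous => x; rewrite inE => /fg.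
Qed.

Lemma continuous_at_near_eq f g x :
  (\forall y \near x, f y = g y) -> {for x, continuous f} ->
  {for x, continuous g}.
Proof.
move=> fg cf; rewrite /prop_for /continuous_at -(nbhs_singleton fg).
by apply: cvg_trans cf; exact: near_eq_cvg.
Qed.

End Within.

Lemma within_comp_at {U V W : topologicalType} (A : set V) (f : V -> U)
    (g : U -> W) :
  (forall x, A x -> {for f x, continuous g}) -> {within A, continuous f} ->
  {within A, continuous (g \o f)}.
Proof.
move=> cg; apply: within_continuous_comp => y; rewrite inE => -[x Ax <-].
exact: cg.
Qed.

Lemma within_nearP {T U : topologicalType} (A : set T) (f : T -> U) :
  {within A, continuous f} <->
  forall x, A x -> forall V, nbhs (f x) V -> \forall y \near x, A y -> V (f y).
Proof.
by split => [/subspace_continuousP cf x Ax V /(cf x Ax)|cf];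
  last by apply/subspace_continuousP => x Ax V /(cf x Ax).
Qed.

Lemma within_comp {T U V : topologicalType} (A : set T) (B : set U)
    (f : T -> U) (g : U -> V) : (forall x, A x -> B (f x)) ->
  {within A, continuous f} -> {within B, continuous g} ->
  {within A, continuous (g \o f)}.
Proof.
move=> AB /subspace_continuousP cf /subspace_continuousP cg.
apply/subspace_continuousP => x Ax W /(cg _ (AB _ Ax)) nW.
have := cf _ Ax _ nW; rewrite /= /nbhs/=.
by apply: filterS2 (withinT _ _) => y Ay; apply; exact: AB.
Qed.

Lemma preimage_open {T U : topologicalType} (f : T -> U) (D : set U) :
  continuous f -> open D -> open (f @^-1` D).
Proof. by move=> /continuousP; apply. Qed.

Lemma pair_continuous_at {Z T U : topologicalType} (f : Z -> T) (g : Z -> U) x :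
  {for x, continuous f} -> {for x, continuous g} ->
  {for x, continuous (fun z => (f z, g z))}.
Proof. by move=> cf cg; exact: cvg_pair cf cg. Qed.

(** Neighborhoods of a point of a quotient space have no convenient description,
but maps from a quotient to Hausdorff spaces are easy to define. *)
Lemma separating_hausdorff (T : topologicalType) :
  (forall x y : T, x <> y -> exists (W : topologicalType) (h : T -> W),
    [/\ hausdorff_space W, continuous h & h x <> h y]) ->
  hausdorff_space T.
Proof.
move=> sep x y xy; apply: contrapT => /sep[W [h [hW ch]]]; apply.
apply: hW => A B /ch hA /ch hB.
by have [z [Az Bz]] := xy _ _ hA hB; exists (h z).
Qed.

Lemma prod_hausdorff (T U : topologicalType) : hausdorff_space T ->
  hausdorff_space U -> hausdorff_space (T * U)%type.
Proof.
move=> hT hU; apply: separating_hausdorff => -[x1 x2] [y1 y2] xy.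
have [xy1|xy1] := pselect (x1 = y1); last first.
  by exists T, fst; split => // p; exact: cvg_fst.
exists U, snd; split => //; first by move=> p; exact: cvg_snd.
by move=> /= xy2; apply: xy; rewrite xy1 xy2.
Qed.

(** The retraction of the whole space to the subtype sending the points outside
[W] to a default value is continuous within [W], and maps [W] onto the
subtype. *)
Lemma set_type_compact {Z : topologicalType} (W : set Z) :
  compact W -> compact [set: set_type W].
Proof.
move=> cW; have [[z0 _]|/set0P/negP] := pselect ([set: set_type W] !=set0);
  last by rewrite negbK => /eqP ->; exact: compact0.
pose j := valL_ z0 (@id (set_type W)).
rewrite (_ : [set: _] = j @` W).
  apply: continuous_compact => //.
  by apply/subspace_valL_continuousP' => x.
apply/seteqP; split => // z _; exists (val z); first exact: set_valP.
exact: (congr1 (fun k => k z) (valLK z0 (@id (set_type W)))).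
Qed.

Section CompactEmbedding.
Context {Y Z : topologicalType} (e : Y -> Z) (y0 : Y).
Hypothesis cY : compact [set: Y].
Hypothesis hZ : hausdorff_space Z.
Hypothesis ce : continuous e.
Hypothesis ie : injective e.

Definition emb_inv (z : Z) : Y := xget y0 [set y | e y = z].

Lemma emb_invK : cancel e emb_inv.
Proof using ie.
by move=> y; apply: ie; rewrite /emb_inv; case: xgetP => // /(_ y); case.
Qed.

Lemma emb_closed (F : set Y) : closed F -> closed (e @` F).
Proof.
move=> cF; apply: compact_closed => //; apply: continuous_compact.
  exact: continuous_subspaceT.
exact: (subclosed_compact cF cY).
Qed.

(** The preimage of a closed set [C] under the inverse is the image of [C], which
is closed because [C] is compact and [Z] is Hausdorff. *)
Lemma emb_inv_continuous : {within range e, continuous emb_inv}.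
Proof.
apply/within_closedP; first exact: emb_closed.
move=> C cC; have -> : range e `&` emb_inv @^-1` C = e @` C.
  apply/seteqP; split => [_ [[y _ <-]]|_ [y Cy <-]] /=; rewrite emb_invK.
    by exists y.
  by split => //; exists y.
exact: emb_closed.
Qed.

Lemma emb_homeomorphic : homeomorphic Y (set_type (range e)).
Proof.
have mem y : e y \in range e by rewrite inE; exists y.
exists (fun y => exist (fun z => z \in range e) _ (mem y)), (emb_inv \o val).
split.
- apply/continuousP => _ [B oB <-].
  by rewrite -comp_preimage; exact: preimage_open.
- exact/subspace_sigL_continuousP/emb_inv_continuous.
- by move=> y /=; exact: emb_invK.
- by move=> [z /[dup] + zr]; rewrite inE => -[y _ yz]; apply: val_inj;
    rewrite /= -yz emb_invK.
Qed.

End CompactEmbedding.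

(** * Normal spaces *)

(** Normality in the form used to shrink an open set around a closed one. *)
Lemma separatedP {Z : topologicalType} (A B : set Z) : normal_space Z ->
  closed A -> open B -> A `<=` B ->
  exists O G, [/\ open O, closed G, A `<=` O, O `<=` G & G `<=` B].
Proof.
move=> nZ cA oB AB; have [|C nC CB] := nZ A cA B.
  by apply/set_nbhsP; exists B; split => // ?.
have [V [oO AO OC]] : exists O, [/\ open O, A `<=` O & O `<=` C].
    by apply/set_nbhsP.
exists V, (closure C); split => //; first exact: closed_closure.
exact: subset_trans OC (@subset_closure _ _).
Qed.

Section Tietze.
Context {R : realType} {Z : topologicalType}.
Hypothesis nZ : normal_space Z.

Lemma tietze01 (F : set Z) (h : Z -> R) : closed F ->
  {within F, continuous h} -> (forall x, F x -> 0 <= h x <= 1) ->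
  exists H : Z -> R, [/\ continuous H, forall x, 0 <= H x <= 1 &
    forall x, F x -> H x = h x].
Proof.
move=> cF ch h01.
have [|H [HE cH _]] := continuous_bounded_extension nZ cF ltr01 ch.
  by move=> x /h01/andP[h0 h1]; rewrite ger0_norm.
exists (fun x => Num.max 0 (Num.min 1 (H x))); split.
- move=> x; apply: (@continuous_max _ _ (cst 0) (fun x => Num.min 1 (H x))).
    exact: cst_continuous.
  by apply: (@continuous_min _ _ (cst 1)); [exact: cst_continuous|exact: cH].
- by move=> x; rewrite le_max lexx/= ge_max ler01 ge_min lexx.
- move=> x Fx; rewrite -HE ?inE//; have /andP[h0 h1] := h01 _ Fx.
  by rewrite (min_idPr h1) (max_idPr h0).
Qed.

(** The time coordinate of a map into a join is extended by this lemma: [C0]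
and [C1] are the sets where one of the two other coordinates is unavailable. *)
Lemma tietze_glue (F C0 C1 : set Z) (t : Z -> R) :
  closed F -> closed C0 -> closed C1 -> {within F, continuous t} ->
  (forall x, F x -> 0 <= t x <= 1) ->
  (forall x, C0 x -> ~ C1 x) ->
  (forall x, F x -> C0 x -> t x = 0) ->
  (forall x, F x -> C1 x -> t x = 1) ->
  exists H : Z -> R, [/\ continuous H, forall x, 0 <= H x <= 1,
    forall x, F x -> H x = t x, forall x, C0 x -> H x = 0 &
    forall x, C1 x -> H x = 1].
Proof.
move=> cF c0 c1 ct t01 c01 F0 F1.
pose h x := if x \in C0 then 0 else if x \in C1 then 1 else t x.
have hF x : F x -> h x = t x.
  move=> Fx; rewrite /h; have [/set_mem|_] := boolP (x \in C0).
    by move/(F0 _ Fx).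
  by have [/set_mem/(F1 _ Fx)|_] := boolP (x \in C1).
have h0 x : C0 x -> h x = 0 by move=> /mem_set; rewrite /h => ->.
have h1 x : C1 x -> h x = 1.
  move=> C1x; rewrite /h (mem_set C1x); case: ifPn => // /set_mem.
  by move=> /c01.
have [||x|H [cH H01 HE]] := @tietze01 (F `|` C0 `|` C1) h.
- by do 2 apply: closedU => //.
- apply: withinU_continuous => //; first exact: closedU.
    apply: withinU_continuous => //.
      by apply: within_eq ct => x /hF.
    apply: (@within_eq _ _ _ (cst 0)) => [x /h0//|].
    exact/continuous_subspaceT/cst_continuous.
  apply: (@within_eq _ _ _ (cst (1 : R))) => [x /h1//|].
  exact/continuous_subspaceT/cst_continuous.
- by move=> [[/[dup] /t01 ? /hF ->//|/h0 ->]|/h1 ->]; rewrite lexx ler01.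
exists H; split=> // x ?; rewrite HE; auto.
- by left; left.
- by left; right.
- by right.
Qed.

End Tietze.

(** * Extension properties *)

(** [nbhd_ext false Z K] says that [K] is a neighborhood extensor for [Z], and
[nbhd_ext true Z K] that it is an absolute extensor for [Z].  The boolean lets
both cases of the theorem on joins be proved together. *)
Definition nbhd_ext (b : bool) (Z K : topologicalType) : Prop :=
  forall (F : set Z) (f : Z -> K), closed F -> {within F, continuous f} ->
  exists O g, [/\ open O, F `<=` O, forall x, O x -> {for x, continuous g},
    forall x, F x -> g x = f x & b -> O = setT].

(** For closed [W] this says that [K] is an absolute extensor for the subspace
[W]; it is expressed in [Z] so that subspaces of subspaces need no coercions.
*)
Definition ext_on {Z : topologicalType} (W : set Z) (K : topologicalType) :=
  forall (F : set Z) (f : Z -> K), closed F -> F `<=` W ->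
  {within F, continuous f} ->
  exists2 g : Z -> K, {within W, continuous g} & forall x, F x -> g x = f x.

Lemma nbhd_ext_true {Z K : topologicalType} :
  nbhd_ext true Z K <-> ext_on [set: Z] K.
Proof.
split=> eK F f cF; [move=> _|] => cf.
  have [U [g [_ _ cg gf /(_ isT) OT]]] := eK F f cF cf.
  by exists g => //; apply: continuous_subspaceT => x; apply: cg; rewrite OT.
have [//|g cg gf] := eK F f cF _ cf; exists setT, g; split => //.
  exact: openT.
by apply/within_openP => //; exact: openT.
Qed.

Lemma ext_on_subset {Z K : topologicalType} (V W : set Z) :
  V `<=` W -> ext_on W K -> ext_on V K.
Proof.
move=> VW eW F f cF FV cf; have [|g cg gf] := eW F f cF _ cf.
  exact: subset_trans FV VW.
by exists g => //; exact: continuous_subspaceW cg.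
Qed.

Lemma ext_on0 {Z K : topologicalType} : ext_on (@set0 Z) K.
Proof. by move=> F f _ F0 _; exists f => //; exact: continuous_subspace0. Qed.

(** The range of [e] is a copy of [Y], by [emb_inv_continuous]. *)
Lemma ext_on_range {Y Z K : topologicalType} (e : Y -> Z) (y0 : Y) :
  compact [set: Y] -> hausdorff_space Z -> continuous e -> injective e ->
  nbhd_ext true Y K <-> ext_on (range e) K.
Proof.
move=> cY hZ ce ie; rewrite nbhd_ext_true.
have eK : cancel e (emb_inv e y0) by exact: emb_invK.
have cinv : {within range e, continuous emb_inv e y0}.
  exact: emb_inv_continuous.
split=> xK F f cF.
- move=> Fe cf.
  have [|//||g cg gf] := xK (e @^-1` F) (f \o e).
  + exact: ((continuous_closedP e).1 ce).
  + by apply: (within_comp _ _ cf) => //; exact: continuous_subspaceT.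
  exists (g \o emb_inv e y0); first by apply: within_comp cinv cg.
  move=> x Fx; have [y _ yx] := Fe _ Fx.
  by rewrite -yx /= eK gf//= yx.
- move=> _ cf.
  have [|||g cg gf] := xK (e @` F) (f \o emb_inv e y0).
  + exact: emb_closed.
  + by move=> _ [y _ <-]; exists y.
  + apply: (within_comp _ _ cf); last first.
      by apply: continuous_subspaceW cinv => _ [y _ <-]; exists y.
    by move=> _ [y Fy <-]; rewrite eK.
  exists (g \o e).
    apply: (within_comp _ _ cg) => [y _|]; first by exists y.
    exact: continuous_subspaceT.
  by move=> y Fy /=; rewrite gf /= ?eK//; exists y.
Qed.

(** * Extension from the union of an exhaustion *)

(** The sets [X k] exhaust an open set in which [F] is closed while it need not
be closed in [Z]. The map [u] is extended by successive steps: after step [k]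
it is extended to a closed subset [G] of [X k], and step [k.+1] starts from the
closed set made of [G] and [F `&` X k.+1]. Keeping a neighborhood of the
previous domain at each step makes the union of all the domains open and the
limit map continuous. *)
Section Sigma.
Context {Z K : topologicalType}.
Variables (b : bool) (X : nat -> set Z) (F : set Z) (u : Z -> K).
Hypothesis nZ : normal_space Z.
Hypothesis extK : nbhd_ext b Z K.
Hypothesis cX : forall k, closed (X k).
Hypothesis iX : forall k, X k `<=` (X k.+1)°.
Hypothesis cF : closed F.
Hypothesis cu : forall k, {within F `&` X k, continuous u}.

Let state : Type := (set Z * (Z -> K))%type.

(* The data after step k are a closed domain s.1 and a map s.2. *)
Let inv k (s : state) := [/\ closed s.1, s.1 `<=` X k,
  F `&` X k `<=` s.1, {within s.1, continuous s.2} &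
  forall x, F x -> s.1 x -> s.2 x = u x].

Let next k (s s' : state) := [/\ inv k.+1 s',
  exists O, [/\ open O, s.1 `<=` O & O `&` X k.+1 `<=` s'.1],
  forall x, s.1 x -> s'.2 x = s.2 x & b -> X k.+1 `<=` s'.1].

Let XS k : X k `<=` X k.+1.
Proof. exact: subset_trans (@iX k) (@interior_subset _ _). Qed.

Let step (p : nat * state) : exists s', inv p.1 p.2 -> next p.1 p.2 s'.
Proof.
case: p => k [G g] /=; have [iGg|] := pselect (inv k (G, g)); last first.
  by move=> n; exists (G, g).
have [/= cG GX FG cg gu] := iGg.
pose h x := if x \in G then g x else u x.
have cH : closed (G `|` F `&` X k.+1) by apply: closedU => //; exact: closedI.
have hG x : G x -> h x = g x by move=> /mem_set; rewrite /h => ->.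
have hF x : F x -> h x = u x.
  by move=> Fx; rewrite /h; case: ifPn => // /set_mem; exact: gu.
have [|V [g' [oV HV cg' g'E bV]]] := extK (f := h) cH.
  apply: withinU_continuous => //; first exact: closedI.
    by apply: within_eq cg => x /hG.
  by apply: (within_eq _ (@cu k.+1)) => x [/hF].
have [V' [G' [oV' cG' HV' V'G' G'V]]] := separatedP nZ cH oV HV.
(* An absolute extensor gives an extension over the whole space, and then
   nothing of X k.+1 may be lost by shrinking. *)
pose G'' := if b then setT else G'.
have [cG'' V'G'' G''V] : [/\ closed G'', V' `<=` G'' & G'' `<=` V].
  by rewrite /G''; case: (b) bV => // bV; split=> //; rewrite bV.
exists (G'' `&` X k.+1, g') => _; split.
- split => /=.
  + exact: closedI.
  + by move=> x [].
  + by move=> x FX; split; [apply/V'G''/HV'; right|case: FX].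
  + apply: (@continuous_subspaceW _ _ _ V).
      by move=> x [/G''V].
    by apply/within_openP.
  + by move=> x Fx [_ Xx]; rewrite g'E ?hF//; right.
- exists V'; split => //=.
  + by move=> x Gx; apply: HV'; left.
  + by move=> x [/V'G''].
- by move=> x Gx /=; rewrite g'E ?hG//; left.
- by rewrite /G'' /= => -> x.
Qed.

Lemma nbhd_ext_sigma : exists U g, [/\ open U, U `<=` \bigcup_k X k,
  F `&` \bigcup_k X k `<=` U, forall x, U x -> {for x, continuous g} &
  forall x, F x -> U x -> g x = u x] /\ (b -> \bigcup_k X k `<=` U).
Proof.
have [sg sgP] := boolp.choice step.
pose s := fix s k : state :=
  if k is k'.+1 then sg (k', s k') else (F `&` X 0, u).
have sI k : inv k (s k).
  elim: k => [|k IH]; last by have [] := sgP (k, s k) IH.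
  by split => //=; first exact: closedI.
have sN k : next k (s k) (s k.+1) by exact: sgP (k, s k) (sI k).
(* A point of X k is interior to X k.+1, so being relatively interior in the
   next domain suffices. *)
have sub k : (s k).1 `<=` ((s k.+1).1)°.
  move=> x sx; have [_ [V [oV sO Os]] _ _] := sN k.
  have [_ sX _ _ _] := sI k.
  apply: filterS Os _; apply: filterI; last exact/iX/sX.
  by apply: open_nbhs_nbhs; split => //; exact: sO.
have mono j k : (j <= k)%N -> (s j).1 `<=` (s k).1 /\
    forall x, (s j).1 x -> (s k).2 x = (s j).2 x.
  elim: k => [|k IH]; first by rewrite leqn0 => /eqP ->; split.
  rewrite leq_eqVlt => /predU1P[->|/IH[jk jkE]]; first by split.
  split; first by move=> x /jk /sub/interior_subset.
  by move=> x sx; have [_ _ sE _] := sN k; rewrite sE ?jkE//; exact: jk.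
have monoE j k x : (s j).1 x -> (s k).1 x -> (s j).2 x = (s k).2 x.
  by move=> sj sk; case: (leqP j k) => [|/ltnW] /mono[_ ->].
pose ix x := if pselect (exists k, `[< (s k).1 x >]) is left e
             then ex_minn e else 0%N.
pose g x := (s (ix x)).2 x.
have gE k x : (s k).1 x -> g x = (s k).2 x.
  move=> sx; rewrite /g /ix; case: pselect; last first.
    by case; exists k; apply/asboolP.
  by move=> e; case: ex_minnP => m /asboolP sm _; exact: monoE.
exists (\bigcup_k (s k).1), g; split; last first.
  move=> bT x [k _ Xx]; exists k.+1 => //; have [_ _ _] := sN k.
  by apply => //; exact: XS.
split.
- rewrite openE => x [k _ /sub sx]; apply: filterS sx => y sy.
  by exists k.+1.
- by move=> x [k _ sx]; exists k => //; have [_ + _ _ _] := sI k; apply.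
- by move=> x [Fx [k _ Xx]]; exists k => //; have [_ _ + _ _] := sI k; apply.
- move=> x [k _ /sub sx].
  apply: (@continuous_at_near_eq _ _ (s k.+1).2).
    by near=> y; apply/esym/gE; near: y.
  have [_ _ _ cs _] := sI k.+1.
  have := cs x; rewrite /continuous_at -(nbhs_subspace_interior sx); exact.
- by move=> x Fx [k _ sx]; rewrite (gE k)//; have [_ _ _ _] := sI k; apply.
Unshelve. all: by end_near. Qed.

End Sigma.

Section Exhaustion.
Context {R : realType} {Z : topologicalType} (T : Z -> R).
Hypothesis cT : continuous T.

(** The exhaustion of the open set where [T < 1]. *)
Definition lt1_exhaust (k : nat) : set Z := [set z | T z <= 1 - k.+1%:R^-1].

Lemma lt1_exhaust_closed k : closed (lt1_exhaust k).
Proof. exact: ((continuous_closedP T).1 cT _ (@closed_le R _)). Qed.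

Lemma lt1_exhaust_interior k : lt1_exhaust k `<=` (lt1_exhaust k.+1)°.
Proof.
have oV : open [set z | T z < 1 - k.+2%:R^-1].
  exact: (preimage_open cT (@open_lt R _)).
have VX : [set z | T z < 1 - k.+2%:R^-1] `<=` lt1_exhaust k.+1.
  by move=> z /ltW.
move=> z Tz; apply: filterS VX _; apply: open_nbhs_nbhs; split => //=.
apply: le_lt_trans Tz _; rewrite ltrD2l ltrN2 ltf_pV2 ?posrE//.
by rewrite ltr_nat.
Qed.

Lemma lt1_exhaustE : \bigcup_k lt1_exhaust k = [set z | T z < 1].
Proof.
apply/seteqP; split => z /=.
  move=> [k _ Tz]; apply: le_lt_trans Tz _.
  by rewrite gtrBl invr_gt0.
move=> Tz; have Tz0 : 0 < 1 - T z by rewrite subr_gt0.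
exists (Num.truncn (1 - T z)^-1) => //; rewrite /lt1_exhaust/=.
rewrite lerBrDr addrC -lerBrDr -[leRHS]invrK lef_pV2 ?posrE ?invr_gt0//.
by rewrite ltW// truncnS_gt.
Qed.

End Exhaustion.

Lemma nbhd_ext_lt1 {R : realType} {Z K : topologicalType} b (F : set Z)
    (T : Z -> R) (u : Z -> K) :
  normal_space Z -> nbhd_ext b Z K -> closed F -> continuous T ->
  (forall k, {within F `&` [set z | T z <= 1 - k.+1%:R^-1], continuous u}) ->
  exists U g, [/\ open U, U `<=` [set z | T z < 1],
    F `&` [set z | T z < 1] `<=` U, forall x, U x -> {for x, continuous g} &
    forall x, F x -> U x -> g x = u x] /\ (b -> [set z | T z < 1] `<=` U).
Proof.
move=> nZ eK cF cT cu; rewrite -(lt1_exhaustE T).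
apply: nbhd_ext_sigma => //.
- exact: lt1_exhaust_closed.
- exact: lt1_exhaust_interior.
Qed.

(** * The topology of the join *)

Section UnitInterval.
Context {R : realType}.

Let clamp_subproof (r : R) : Num.max 0 (Num.min 1 r) \in [set` `[(0 : R), 1]].
Proof. by rewrite inE/= in_itv/= le_max lexx/= ge_max ler01 ge_min lexx. Qed.

(** A total map onto the unit interval, so that time coordinates can be handled
as real-valued functions. *)
Definition clamp (r : R) : unit_interval R :=
  exist (fun x : R => x \in [set` `[0, 1]]) _ (clamp_subproof r).

Definition uval (s : unit_interval R) : R := val s.

Lemma val_clamp (r : R) : 0 <= r <= 1 -> uval (clamp r) = r.
Proof. by move=> /andP[r0 r1]; rewrite /uval/= (min_idPr r1) (max_idPr r0). Qed.

Lemma unit_interval_itv (s : unit_interval R) : 0 <= uval s <= 1.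
Proof. by have := set_valP s; rewrite /= in_itv. Qed.

Lemma clampK (s : unit_interval R) : clamp (uval s) = s.
Proof. by apply: val_inj; rewrite -/(uval _) val_clamp// unit_interval_itv. Qed.

Lemma val_unit_continuous : continuous uval.
Proof. exact: initial_continuous. Qed.

Lemma clamp_continuous : continuous clamp.
Proof.
apply/continuousP => _ [B oB <-].
rewrite -comp_preimage; apply: preimage_open => // x.
apply: (@continuous_max _ _ (cst (0 : R)) (fun x => Num.min (1 : R) x)).
  exact: cst_continuous.
by apply: (@continuous_min _ _ (cst (1 : R))); [exact: cst_continuous|].
Qed.

Lemma unit_interval_compact : compact [set: unit_interval R].
Proof.
rewrite (_ : [set: _] = clamp @` `[0, 1]).
  apply: continuous_compact; last exact: segment_compact.
  exact/continuous_subspaceT/clamp_continuous.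
apply/seteqP; split=> // s _; exists (uval s); last exact: clampK.
by rewrite /= in_itv/= unit_interval_itv.
Qed.

End UnitInterval.

Section JoinTopology.
Context {R : realType} {K L : topologicalType}.
Local Notation J := (join R K L).
Local Notation P := (K * L * unit_interval R)%type.

Definition jpi (p : P) : J := \pi_{eq_quot (@join_equiv R K L)} p.

Definition mkjoin (k : K) (l : L) (r : R) : J := jpi (k, l, clamp r).

(** [join_time] is well defined on classes, whereas [join_left] is meaningful
only at times below 1 and [join_right] only at positive times; at the other
times they depend on the representative. *)
Definition join_time (q : J) : R := uval (repr q).2.
Definition join_left (q : J) : K := (repr q).1.1.
Definition join_right (q : J) : L := (repr q).1.2.

Lemma jpi_continuous : continuous jpi.
Proof. exact: pi_continuous. Qed.

Lemma jpi_eqP (p q : P) : jpi p = jpi q <-> join_rel p q.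
Proof. by split => [/eqquotP|?]; last apply/eqquotP. Qed.

Lemma repr_jpi (p : P) : join_rel (repr (jpi p)) p.
Proof. by apply/jpi_eqP; rewrite /jpi reprK. Qed.

Lemma jpi_repr (q : J) : jpi (repr q) = q.
Proof. exact: reprK. Qed.

Lemma join_time_jpi (p : P) : join_time (jpi p) = uval p.2.
Proof.
by rewrite /join_time /uval; have /asboolP[->|[[-> ->]|[-> ->]]] := repr_jpi p.
Qed.

Lemma join_left_jpi (p : P) : uval p.2 < 1 -> join_left (jpi p) = p.1.1.
Proof.
rewrite /uval /join_left; have /asboolP[->|[[]|[_ ->]]]// := repr_jpi p.
by rewrite ltxx.
Qed.

Lemma join_right_jpi (p : P) : 0 < uval p.2 -> join_right (jpi p) = p.1.2.
Proof.
rewrite /uval /join_right; have /asboolP[->|[[_ ->]|[]]]// := repr_jpi p.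
by rewrite ltxx.
Qed.

Lemma mkjoinK (q : J) : mkjoin (join_left q) (join_right q) (join_time q) = q.
Proof.
rewrite -[RHS]jpi_repr /mkjoin /join_time clampK; congr jpi.
by rewrite /join_left /join_right; case: (repr q) => -[].
Qed.

Lemma join_time_itv (q : J) : 0 <= join_time q <= 1.
Proof. exact: unit_interval_itv. Qed.

Lemma eq_mkjoin (k k' : K) (l l' : L) (r : R) : 0 <= r <= 1 ->
  (r < 1 -> k = k') -> (0 < r -> l = l') -> mkjoin k l r = mkjoin k' l' r.
Proof.
move=> r01 kk' ll'; apply/jpi_eqP/asboolP.
have vr := val_clamp r01.
have [r0|r0] := ltP 0 r; last first.
  have rE : r = 0 by apply/eqP; rewrite eq_le r0; case/andP: r01.
  right; left; split; [exact: etrans vr rE|exact: etrans vr rE|].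
  by apply: kk'; rewrite rE.
have [r1|r1] := ltP r 1; first by left; rewrite kk'// ll'.
have rE : r = 1 by apply/eqP; rewrite eq_le r1; case/andP: r01 => _ ->.
right; right; split; [exact: etrans vr rE|exact: etrans vr rE|].
by apply: ll'; rewrite rE.
Qed.

Lemma join_time_continuous : continuous join_time.
Proof.
apply/quotient_continuous => p.
have -> : join_time \o \pi_J = uval \o snd.
  by apply/funext => q; exact: join_time_jpi.
apply: (@continuous_comp _ _ _ snd uval); first exact: cvg_snd.
exact: val_unit_continuous.
Qed.

(** The preimage of an open set of [K] under [join_left], cut down to the times
below 1, is saturated: it comes from the points of [K * L * unit_interval R]
with time below 1 and first coordinate in the given set. *)
Lemma join_left_continuous q : join_time q < 1 -> {for q, continuous join_left}.
Proof.
pose V := [set q | join_time q < 1].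
have oV : open V.
  exact: (preimage_open join_time_continuous (@open_lt R 1)).
suff cV : {in V, continuous join_left} by move=> Vq; apply: cV; rewrite inE.
apply/continuous_inP => // W oW.
rewrite /open/= /quotient_open.
have -> : \pi_J @^-1` (V `&` join_left @^-1` W) =
    [set p | uval p.2 < 1] `&` (fun p : P => p.1.1) @^-1` W.
  apply/seteqP; split => p /=; rewrite -/(jpi p) /V/= join_time_jpi => -[p1].
    by rewrite join_left_jpi.
  by rewrite join_left_jpi.
apply: openI.
  apply: (preimage_open (f := uval \o snd) _ (@open_lt R 1)).
  move=> p; apply: (@continuous_comp _ _ _ snd uval); first exact: cvg_snd.
  exact: val_unit_continuous.
apply: (preimage_open (f := fst \o fst)) => // p.
by apply: continuous_comp; exact: cvg_fst.
Qed.

Lemma join_right_continuous q : 0 < join_time q ->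
  {for q, continuous join_right}.
Proof.
pose V := [set q | 0 < join_time q].
have oV : open V.
  exact: (preimage_open join_time_continuous (@open_gt R 0)).
suff cV : {in V, continuous join_right} by move=> Vq; apply: cV; rewrite inE.
apply/continuous_inP => // W oW.
rewrite /open/= /quotient_open.
have -> : \pi_J @^-1` (V `&` join_right @^-1` W) =
    [set p | 0 < uval p.2] `&` (fun p : P => p.1.2) @^-1` W.
  apply/seteqP; split => p /=; rewrite -/(jpi p) /V/= join_time_jpi => -[p1].
    by rewrite join_right_jpi.
  by rewrite join_right_jpi.
apply: openI.
  apply: (preimage_open (f := uval \o snd) _ (@open_gt R 0)).
  move=> p; apply: (@continuous_comp _ _ _ snd uval); first exact: cvg_snd.
  exact: val_unit_continuous.
apply: (preimage_open (f := snd \o fst)) => // p.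
by apply: continuous_comp; [exact: cvg_fst|exact: cvg_snd].
Qed.

Lemma join_compact : compact [set: K] -> compact [set: L] -> compact [set: J].
Proof.
move=> cK cL; rewrite (_ : [set: J] = jpi @` setT).
  apply: continuous_compact; first exact/continuous_subspaceT/jpi_continuous.
  have := compact_setX (compact_setX cK cL) (@unit_interval_compact R).
  by rewrite !setXTT.
by apply/seteqP; split=> // q _; exists (repr q) => //; exact: jpi_repr.
Qed.

(** At time 0 nothing is known about [v]. But [mkjoin (u x) l 0] does not depend
on [l], so for each [l] the points [mkjoin (u z) l' (T z)] are close to it for
[z] near [x] and [l'] near [l]; compactness of [L] makes this uniform in [l].
Time 1 is symmetric. *)
Lemma mkjoin_continuous_at {Z : topologicalType} (u : Z -> K) (v : Z -> L)
    (T : Z -> R) (x : Z) : compact [set: K] -> compact [set: L] ->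
  (forall z, 0 <= T z <= 1) -> {for x, continuous T} ->
  (T x < 1 -> {for x, continuous u}) -> (0 < T x -> {for x, continuous v}) ->
  {for x, continuous (fun z => mkjoin (u z) (v z) (T z))}.
Proof.
move=> cK cL T01 cT cu cv; have [Tx0|Tx0] := ltP 0 (T x); last first.
  have Tx : T x = 0 by apply/eqP; rewrite eq_le Tx0; case/andP: (T01 x).
  have {}cu := cu _.
  move=> Q nQ.
  have H l : [set: L] l -> \forall l' \near l & z \near x,
      Q (mkjoin (u z) l' (T z)).
    move=> _.
    have : {for (l, x), continuous
        (jpi \o (fun p : L * Z => (u p.2, p.1, clamp (T p.2))))}.
      apply: continuous_comp; last exact: jpi_continuous.
      apply: pair_continuous_at; first apply: pair_continuous_at.
      - apply: (@continuous_comp _ _ _ snd u); first exact: cvg_snd.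
        by apply: cu; rewrite Tx.
      - exact: cvg_fst.
      - apply: (@continuous_comp _ _ _ (T \o snd) clamp).
          by apply: continuous_comp; [exact: cvg_snd|exact: cT].
        exact: clamp_continuous.
    apply; rewrite /= -/(mkjoin _ _ _) (@eq_mkjoin _ (u x) _ (v x))// Tx ltxx//.
  have nH := (compact_near_coveringP [set: L]).1 cL Z (nbhs x)
    (fun z l => Q (mkjoin (u z) l (T z))) (nbhs_filter x) H.
  suff : \forall z \near x, Q (mkjoin (u z) (v z) (T z)) by [].
  by near=> z; exact: (near nH z).
have [Tx1|Tx1] := ltP (T x) 1.
  apply: (@continuous_comp _ _ _ (fun z => (u z, v z, clamp (T z))) jpi).
    apply: pair_continuous_at.
      by apply: pair_continuous_at; [exact: cu|exact: cv].
    by apply: (@continuous_comp _ _ _ T clamp) => //; exact: clamp_continuous.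
  exact: jpi_continuous.
have Tx : T x = 1 by apply/eqP; rewrite eq_le Tx1; case/andP: (T01 x) => _ ->.
move=> Q nQ.
have H k : [set: K] k -> \forall k' \near k & z \near x,
    Q (mkjoin k' (v z) (T z)).
  move=> _.
  have : {for (k, x), continuous
      (jpi \o (fun p : K * Z => (p.1, v p.2, clamp (T p.2))))}.
    apply: continuous_comp; last exact: jpi_continuous.
    apply: pair_continuous_at; first apply: pair_continuous_at.
    - exact: cvg_fst.
    - apply: (@continuous_comp _ _ _ snd v); first exact: cvg_snd.
      exact: cv.
    - apply: (@continuous_comp _ _ _ (T \o snd) clamp).
        by apply: continuous_comp; [exact: cvg_snd|exact: cT].
      exact: clamp_continuous.
  apply; rewrite /= -/(mkjoin _ _ _) (@eq_mkjoin _ (u x) _ (v x))// Tx ltxx//.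
have nH := (compact_near_coveringP [set: K]).1 cK Z (nbhs x)
  (fun z k => Q (mkjoin k (v z) (T z))) (nbhs_filter x) H.
suff : \forall z \near x, Q (mkjoin (u z) (v z) (T z)) by [].
  by near=> z; exact: (near nH z).
Unshelve. all: by end_near. Qed.

End JoinTopology.

(** * Extension of maps into joins *)

Section JoinExt.
Context {R : realType} {Z K L : topologicalType}.

(** The extension of a map [f] from [F] to the join goes as follows.  Its time
[t] is extended to [T0], and its right coordinate to an open set [V] of points
where [T0 > 0].  A second extension [T'] of [t] vanishes outside [V], and the
left coordinate is extended to an open set [U] of points where [T' < 1].  A
third extension [T1] of [t] also vanishes where [T'] does, hence outside [V],
and is equal to 1 at the points outside [U] where [T' >= 1/2].  Then [T1], with
the two extended coordinates, defines a map to the join on [W]: the points of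
[U] together with those where [T' > 1/2].  If [K] is an absolute extensor, [U]
is all of [T' < 1], so [W] is the whole space. *)
Lemma nbhd_ext_join b :
  normal_space Z -> compact [set: K] -> compact [set: L] ->
  nbhd_ext b Z K -> nbhd_ext false Z L -> nbhd_ext b Z (join R K L).
Proof.
move=> nZ cK cL eK eL F f cF cf.
pose t := join_time \o f.
have t01 x : F x -> 0 <= t x <= 1 by move=> _; exact: join_time_itv.
have ct : {within F, continuous t}.
  by apply: within_comp_at cf => x _; exact: join_time_continuous.
have [T0 [cT0 T001 T0E]] := tietze01 nZ cF ct t01.
have [|k|V [v [[oV V0 FV cv vE] _]]] := @nbhd_ext_lt1 R _ _ false F
    (fun z => 1 - T0 z) (join_right \o f) nZ eL cF.
- by move=> x; apply: continuousB; [exact: cst_continuous|exact: cT0].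
- apply: within_comp_at; last by apply: continuous_subspaceW cf => x [].
  move=> x [Fx /=]; rewrite T0E// => tk; apply: join_right_continuous.
  change (0 < t x); have : 0 < k.+1%:R^-1 :> R by rewrite invr_gt0.
  by move: tk; set e := _^-1; lra.
have FV' x : F x -> 0 < t x -> V x.
  by move=> Fx tx; apply: FV; split => //=; rewrite T0E//; lra.
have [|||T' [cT' T'01 T'F T'V _]] :=
    @tietze_glue R _ nZ F (~` V) set0 t cF (open_closedC oV) closed0 ct t01.
- by move=> x _ [].
- move=> x Fx nVx; have /andP[+ _] := t01 _ Fx.
  by rewrite le_eqVlt => /predU1P[<-//|/(FV' _ Fx)].
- by move=> x _ [].
have [|U [u [[oU U1 FU cu uE] bU]]] := @nbhd_ext_lt1 R _ _ b F
    T' (join_left \o f) nZ eK cF cT'.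
  move=> k; apply: within_comp_at; last by apply: continuous_subspaceW cf => x [].
  move=> x [Fx /=]; rewrite T'F// => tk; apply: join_left_continuous.
  change (t x < 1); have : 0 < k.+1%:R^-1 :> R by rewrite invr_gt0.
  by move: tk; set e := _^-1; lra.
have FU' x : F x -> t x < 1 -> U x.
  by move=> Fx tx; apply: FU; split => //=; rewrite T'F.
pose C1 := [set x | 1 / 2 <= T' x] `&` ~` U.
have cC0 : closed [set x | T' x <= 0].
  exact: ((continuous_closedP T').1 cT' _ (@closed_le R _)).
have cC1 : closed C1.
  apply: closedI; last exact: open_closedC.
  exact: ((continuous_closedP T').1 cT' _ (@closed_ge R _)).
have [|||T1 [cT1 T101 T1F T10 T11]] :=
    @tietze_glue R _ nZ F _ C1 t cF cC0 cC1 ct t01.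
- by move=> x /= T'x [/=]; lra.
- move=> x Fx /=; rewrite T'F// => tx; have := t01 _ Fx; lra.
- move=> x Fx [_ nU]; have /andP[_] := t01 _ Fx.
  by rewrite le_eqVlt => /predU1P[//|/(FU' _ Fx)].
pose W := U `|` [set x | 1 / 2 < T' x].
have WU x : W x -> T1 x < 1 -> U x.
  move=> [//|/= T'x] T1x; apply: contrapT => nU.
  by move: T1x; rewrite T11 ?ltxx//; split => //=; exact: ltW.
have WV x : 0 < T1 x -> V x.
  move=> T1x; apply: contrapT => nV.
  by move: T1x; rewrite T10 ?ltxx//= T'V.
exists W, (fun x => mkjoin (u x) (v x) (T1 x)); split.
- apply: openU => //; exact: (preimage_open cT' (@open_gt R _)).
- move=> x Fx; have [/(FU' _ Fx)|tx] := ltP (t x) 1; first by left.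
  by right => /=; rewrite T'F//; lra.
- move=> x Wx; apply: mkjoin_continuous_at => //; first exact: cT1.
    by move=> ?; apply/cu/WU.
  by move=> ?; apply/cv/WV.
- move=> x Fx; rewrite T1F// -[RHS]mkjoinK; apply: eq_mkjoin.
  + exact: t01.
  + by move=> tx; rewrite uE//; exact: FU'.
  + by move=> tx; rewrite vE//; exact: FV'.
- move=> bT; apply/seteqP; split=> // x _.
  have [T'x|T'x] := ltP (T' x) 1; first by left; exact: bU.
  by right => /=; lra.
Qed.

End JoinExt.

Lemma join_powS_compact {R : realType} (L : topologicalType) n :
  compact [set: L] -> compact [set: join_powS R L n].
Proof. by move=> cL; elim: n => [//|n IH] /=; exact: join_compact. Qed.

Lemma nbhd_ext_join_powS {R : realType} (Z L : topologicalType) n :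
  normal_space Z -> compact [set: L] -> nbhd_ext false Z L ->
  nbhd_ext false Z (join_powS R L n).
Proof.
move=> nZ cL eL; elim: n => [//|n IH] /=; apply: nbhd_ext_join => //.
exact: join_powS_compact.
Qed.

(** This is why the L-dimension can be read off from a threshold: the case
[b = true] of [nbhd_ext_join] shows that being an absolute extensor is
inherited by the next join power. *)
Lemma nbhd_ext_join_powS_mono {R : realType} (Z L : topologicalType) m n :
  normal_space Z -> compact [set: L] -> nbhd_ext false Z L -> (m <= n)%N ->
  nbhd_ext true Z (join_powS R L m) -> nbhd_ext true Z (join_powS R L n).
Proof.
move=> nZ cL eL mn em; elim: n mn => [|n IH].
  by rewrite leqn0 => /eqP <-.
rewrite leq_eqVlt => /predU1P[<-//|/IH en] /=; apply: nbhd_ext_join => //.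
exact: join_powS_compact.
Qed.

(** * Compact metric absolute neighborhood retracts *)

Section CappedSup.
Context {R : realType} {L : Type}.
Implicit Types f g h : L -> R.

(** The uniform distance, capped at 1 so that it is defined for unbounded
functions; the element 0 keeps the set non-empty when [L] is empty. *)
Definition cap_dist f g : R :=
  sup (0 |` range (fun l => Num.min 1 `|f l - g l|)).

Lemma cap_dist_le f g e : 0 <= e ->
  (forall l, Num.min 1 `|f l - g l| <= e) -> cap_dist f g <= e.
Proof.
move=> e0 fg; apply: ge_sup; first by exists 0; left.
by move=> _ [->|[l _ <-]].
Qed.

Let ub f g : has_ubound (0 |` range (fun l => Num.min 1 `|f l - g l|)).
Proof. by exists 1 => _ [->|[l _ <-]]; rewrite ?ler01// ge_min lexx. Qed.

Lemma le_cap_dist f g l : Num.min 1 `|f l - g l| <= cap_dist f g.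
Proof. by apply: ub_le_sup => //; right; exists l. Qed.

Lemma cap_dist_ge0 f g : 0 <= cap_dist f g.
Proof. by apply: ub_le_sup => //; left. Qed.

Lemma cap_distxx f : cap_dist f f = 0.
Proof.
apply/eqP; rewrite eq_le cap_dist_ge0 andbT; apply: cap_dist_le => // l.
by rewrite subrr normr0 ge_min lexx orbT.
Qed.

Lemma cap_dist_eq0 f g : cap_dist f g = 0 -> f = g.
Proof.
move=> fg; apply/funext => l; have := le_cap_dist f g l.
by rewrite fg ge_min ler10/= normr_le0 subr_eq0 => /eqP.
Qed.

Lemma cap_dist_sym f g : cap_dist f g = cap_dist g f.
Proof.
by rewrite /cap_dist; under eq_fun do rewrite distrC.
Qed.

Lemma cap_dist_triangle g f h :
  cap_dist f h <= cap_dist f g + cap_dist g h.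
Proof.
apply: cap_dist_le => [|l]; first by rewrite addr_ge0 ?cap_dist_ge0.
apply: le_trans (lerD (le_cap_dist f g l) (le_cap_dist g h l)).
have : `|f l - h l| <= `|f l - g l| + `|g l - h l|.
  by apply: le_trans (ler_normD _ _); rewrite addrA subrK.
have := normr_ge0 (f l - g l); have := normr_ge0 (g l - h l).
by rewrite !minElt; do 3 case: ifPn; rewrite -?leNgt; lra.
Qed.

End CappedSup.

Definition fun_metric (R : realType) (L : Type) : Type := L -> R.

HB.instance Definition _ (R : realType) (L : Type) :=
  gen_eqMixin (fun_metric R L).
HB.instance Definition _ (R : realType) (L : Type) :=
  gen_choiceMixin (fun_metric R L).
HB.instance Definition _ (R : realType) (L : Type) :=
  @isMetric.Build R (fun_metric R L) cap_dist cap_distxx cap_dist_eq0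
    cap_dist_sym cap_dist_triangle.

Section ANR.
Context {R : realType} {L : metricType R}.
Implicit Types x y l : L.

(** The Kuratowski embedding. The cap at 1 makes these functions bounded, which
is what Tietze's theorem asks for, and keeps the map injective and 1-Lipschitz.
*)
Definition kuratowski l : fun_metric R L := fun y => Num.min 1 (mdist l y).

Let min1_lip (a b : R) : `|Num.min 1 a - Num.min 1 b| <= `|a - b|.
Proof.
rewrite !minElt; case: (ltP 1 a) => a1; case: (ltP 1 b) => b1 //.
- by rewrite subrr normr0 normr_ge0.
- by rewrite !ger0_norm; lra.
- by rewrite !ler0_norm; lra.
Qed.

Lemma mdist_lip x y l : `|mdist x l - mdist y l| <= mdist x y.
Proof.
rewrite ler_norml; have := metric_triangle x y l; have := metric_triangle y x l.
by rewrite (metric_sym y x); lra.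
Qed.

Lemma kuratowski_continuous : continuous kuratowski.
Proof.
move=> x; apply/metricType_numDomainType.cvgrPdist_lt => e e0.
near=> y.
apply: (@le_lt_trans _ _ (mdist x y)).
  apply: cap_dist_le => [|l]; first exact: mdist_ge0.
  rewrite ge_min; apply/orP; right.
  exact: le_trans (min1_lip _ _) (mdist_lip _ _ _).
near: y; apply/nbhs_ballP; exists e => //=.
by rewrite ballEmdist.
Unshelve. all: by end_near. Qed.

Lemma kuratowski_inj : injective kuratowski.
Proof.
move=> x y /(congr1 (fun f : fun_metric R L => f y)); rewrite /kuratowski mdistxx.
rewrite (min_idPr ler01) minElt; case: ifPn => _ xy; last exact: mdist_positivity.
by have := oner_neq0 R; rewrite xy eqxx.
Qed.

Lemma within_mdist {Z : topologicalType} (A : set Z) (f g : Z -> L) :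
  {within A, continuous f} -> {within A, continuous g} ->
  {within A, continuous (fun z => mdist (f z) (g z))}.
Proof.
move=> cf cg z; apply/cvgrPdist_lt => e e0.
have e20 : 0 < e / 2 by rewrite divr_gt0.
have /metricType_numDomainType.cvgrPdist_lt/(_ _ e20) nf := cf z.
have /metricType_numDomainType.cvgrPdist_lt/(_ _ e20) ng := cg z.
near=> w; have fw : mdist (f z) (f w) < e / 2 by near: w.
have gw : mdist (g z) (g w) < e / 2 by near: w.
rewrite /from_subspace.
have := mdist_lip (f z) (f w) (g z); have := mdist_lip (g z) (g w) (f w).
rewrite !ler_norml (metric_sym (g z) (f w)) (metric_sym (g w) (f w)).
rewrite ltr_norml; lra.
Unshelve. all: by end_near. Qed.

(** A function space serves as the ambient metric space because a map from [Z]
to it is a function of two variables. The Kuratowski image of [f] is a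
real-valued function on [F `*` [set: L]], which extends to [Z * L] by Tietze's
theorem; compactness of [L] turns the extension back into a continuous map
[gam] from [Z] to the function space. Where [gam] takes values in the
neighborhood [U] of the image of [L], it can be retracted to [L]. *)
Lemma ANR_nbhd_ext (Z : topologicalType) : [set: L] !=set0 ->
  compact [set: L] -> ANR R L -> compact [set: Z] -> hausdorff_space Z ->
  nbhd_ext false Z L.
Proof.
move=> [l0 _] cL anrL cZ hZ F f cF cf.
have hL : hausdorff_space L := @metric_hausdorff _ _.
have hM : hausdorff_space (fun_metric R L) := @metric_hausdorff _ _.
have cK := kuratowski_continuous; have iK := kuratowski_inj.
have [U [r [oU AU cr rUA rA]]] := anrL (fun_metric R L) (range kuratowski)
  (emb_closed cL hM cK closedT) (emb_homeomorphic l0 cL hM cK iK).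
have nZL : normal_space (Z * L)%type.
  apply: compact_normal; first exact: prod_hausdorff.
  by have := compact_setX cZ cL; rewrite setXTT.
have cFL : closed (F `*` [set: L]).
  rewrite (_ : _ `*` _ = fst @^-1` F); last by apply/seteqP; split=> p //= [].
  by apply: (continuous_closedP fst).1 => // p; exact: cvg_fst.
have [||G [cG G01 GE]] :=
    @tietze01 R _ nZL _ (fun p => kuratowski (f p.1) p.2) cFL.
- apply: (@within_comp_at _ _ _ _ (fun p => mdist (f p.1) p.2)
    (fun s => Num.min 1 s)).
    move=> p _; apply: (@continuous_min _ _ (cst (1 : R)) id).
      exact: cst_continuous.
    exact: cvg_id.
  apply: within_mdist; last first.
    by apply: continuous_subspaceT => p; exact: cvg_snd.
  apply: (@within_comp _ _ _ _ F) => //; first by move=> p [].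
  by apply: continuous_subspaceT => p; exact: cvg_fst.
- by move=> p _; rewrite le_min ler01 mdist_ge0 ge_min lexx.
pose gam z : fun_metric R L := fun l => G (z, l).
have gamE z : F z -> gam z = kuratowski (f z).
  by move=> Fz; apply/funext => l; rewrite /gam GE.
have cgam : continuous gam.
  move=> z; apply/metricType_numDomainType.cvgrPdist_lt => e e0.
  have e20 : 0 < e / 2 by rewrite divr_gt0.
  have H l : [set: L] l -> \forall l' \near l & z' \near z,
      `|G (z, l') - G (z', l')| < e / 2.
    move=> _.
    have c1 : {for (l, z), continuous
        (fun p : L * Z => G (z, p.1) - G (p.2, p.1))}.
      apply: continuousB.
        apply: (@continuous_comp _ _ _ (fun p : L * Z => (z, p.1)) G);
          last exact: cG.
        by apply: pair_continuous_at; [exact: cvg_cst|exact: cvg_fst].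
      apply: (@continuous_comp _ _ _ (fun p : L * Z => (p.2, p.1)) G);
        last exact: cG.
      by apply: pair_continuous_at; [exact: cvg_snd|exact: cvg_fst].
    have /cvgrPdist_lt/(_ _ e20) := c1.
    by apply: filterS => p /=; rewrite subrr sub0r normrN.
  have nH := (compact_near_coveringP [set: L]).1 cL Z (nbhs z)
    (fun z' l => `|G (z, l) - G (z', l)| < e / 2) (nbhs_filter z) H.
  near=> z'; apply: (@le_lt_trans _ _ (e / 2)); last first.
    by rewrite ltr_pdivrMr// ltr_pMr// ltr1n.
  apply: cap_dist_le => [|l]; first exact: ltW.
  by rewrite ge_min; apply/orP; right; apply: ltW; exact: (near nH z').
have cinv := @emb_inv_continuous _ _ _ l0 cL hM cK iK.
exists (gam @^-1` U), (emb_inv kuratowski l0 \o r \o gam); split => //.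
- exact: preimage_open.
- by move=> z Fz /=; apply: AU; rewrite gamE//; exists (f z).
- move=> z Uz; apply: continuous_comp; first exact: cgam.
  have crU : {within U, continuous (emb_inv kuratowski l0 \o r)}.
    by apply: (within_comp _ cr cinv) => m Um; apply: rUA; exists m.
  exact: ((within_openP _ oU).1 crU).
- move=> z Fz /=; rewrite gamE// rA; last by exists (f z).
  exact: emb_invK iK _.
Unshelve. all: by end_near. Qed.

End ANR.

(** * Extension along fibres *)

(** Extend first over the fibre over [b0], then to a neighborhood [U] of it by
[g'].  The image of the compact set [W `\` U] is closed and misses [b0], so its
complement [N] is a neighborhood of [b0] whose fibres lie in [U].  Use [g']
over [N]; the other fibres are open in [W], and extensions over them can be
chosen independently. *)
Lemma ext_on_fibres {Z B K : topologicalType} (W : set Z) (p : Z -> B)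
    (b0 : B) :
  compact [set: Z] -> hausdorff_space Z -> hausdorff_space B ->
  closed W -> {within W, continuous p} ->
  (forall b, b <> b0 -> open [set b]) ->
  nbhd_ext false Z K ->
  (forall b, ext_on (W `&` p @^-1` [set b]) K) -> ext_on W K.
Proof.
move=> cZ hZ hB cW cp iB eK fK F f cF FW cf.
pose Wb b := W `&` p @^-1` [set b].
have cWb b : closed (Wb b).
  apply: ((within_closedP p cW).1 cp); apply: compact_closed => //.
  exact: compact_set1.
have cWF b : closed (F `&` Wb b) by exact: closedI.
have /boolp.choice[g gP] b : exists g, {within Wb b, continuous g} /\
    forall x, F x -> Wb b x -> g x = f x.
  have [||g cg gf] := fK b (F `&` Wb b) f (cWF b).
  - by move=> x [].
  - by apply: continuous_subspaceW cf => x [].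
  by exists g; split => // x Fx Wx; exact: gf.
pose h0 x := if x \in Wb b0 then g b0 x else f x.
have h0W x : Wb b0 x -> h0 x = g b0 x by move=> /mem_set; rewrite /h0 => ->.
have h0F x : F x -> h0 x = f x.
  by move=> Fx; rewrite /h0; case: ifPn => // /set_mem; exact: (gP b0).2.
have [||U [g' [oO FO cg' g'h0 _]]] := eK (F `|` Wb b0) h0.
- exact: closedU.
- apply: withinU_continuous => //.
    by apply: within_eq cf => x /h0F.
  by apply: within_eq (gP b0).1 => x /h0W.
pose N := ~` (p @` (W `&` ~` U)).
have oN : open N.
  apply: closed_openC; apply: compact_closed => //.
  apply: continuous_compact; first by apply: continuous_subspaceW cp => x [].
  apply: (subclosed_compact _ cZ) => //.
  by apply: closedI => //; exact: open_closedC.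
have Nb0 : N b0.
  by move=> [x [Wx nUx] px]; apply: nUx; apply: FO; right.
have NO x : W x -> N (p x) -> U x.
  by move=> Wx Nx; apply: contrapT => nUx; apply: Nx; exists x.
pose h z := if p z \in N then g' z else g (p z) z.
exists h; last first.
  move=> x Fx; rewrite /h; case: ifPn => _.
    by rewrite g'h0 ?h0F//; left.
  by rewrite (gP _).2//; split => //; exact: FW.
have /within_nearP cp' := cp.
apply/within_nearP => x Wx V.
rewrite {1}/h; case: ifPn => [/set_mem Nx|nNx] nV.
  have nN : \forall y \near x, W y -> N (p y).
    by apply: cp' => //; apply: open_nbhs_nbhs; split.
  have nV' : \forall y \near x, V (g' y).
    exact: (cg' x (NO x Wx Nx) V nV).
  near=> y => Wy; rewrite /h mem_set; first by near: y.
  by move: Wy; near: y.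
have xb0 : p x <> b0 by move=> xb0; move: nNx; rewrite xb0 mem_set.
have nx : \forall y \near x, W y -> p y = p x.
  by apply: (cp' x Wx [set p x]); apply: open_nbhs_nbhs; split => //; exact: iB.
have /within_nearP cg := (gP (p x)).1.
have nV' : \forall y \near x, Wb (p x) y -> V (g (p x) y) by exact: cg nV.
near=> y => Wy; rewrite /h.
have -> : p y = p x by move: Wy; near: y.
rewrite (negbTE nNx); have pyx : p y = p x by move: Wy; near: y.
have Wby : Wb (p x) y by split.
by move: Wby; near: y.
Unshelve. all: by end_near. Qed.

(** * One-point compactifications of discrete spaces *)

Section OnePoint.
Context {D : choiceType}.

Lemma A_compact : compact [set: A_ D].
Proof. exact: one_point_compactification_compact. Qed.

Lemma A_hausdorff : hausdorff_space (A_ D).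
Proof.
apply: one_point_compactification_hausdorff; last exact: discrete_hausdorff.
move=> x _; rewrite withinET; exists [set x]; first exact: discrete_set1.
by split; [exact: compact_set1|exact: discrete_closed].
Qed.

Lemma A_isolated (b : A_ D) : b <> mu -> open [set b].
Proof.
case: b => // d _; rewrite (_ : [set _] = Some @` [set d]).
  exact/one_point_compactification_open_some/discrete_open.
by apply/seteqP; split => [_ ->|_ [_ -> <-]] //; exists d.
Qed.

End OnePoint.

Section FinOrSeq.
Context {X : topologicalType}.
Hypothesis hX : hausdorff_space X.

Lemma fin_or_seq_closed (S : set X) : fin_or_seq X S -> closed S.
Proof.
move=> [fS|[f [g [cf cg fK gK]]]]; apply: compact_closed => //.
  exact: finite_compact.
rewrite (_ : S = (val \o g) @` setT).
  apply: continuous_compact; last exact: A_compact.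
  apply: continuous_subspaceT => a; apply: continuous_comp; first exact: cg.
  exact: initial_continuous.
apply/seteqP; split => [x Sx|_ [a _ <-]]; last exact: set_valP.
by exists (f (exist _ x (mem_set Sx))) => //=; rewrite fK.
Qed.

(** Finite sets are discrete, so that any injective numbering is continuous on
them; for infinite sets in the family this is the given homeomorphism. *)
Lemma fin_or_seq_code (S : set X) : fin_or_seq X S ->
  exists j : X -> A_ nat, {within S, continuous j} /\ {in S &, injective j}.
Proof.
move=> [fS|[f [g [cf cg fK gK]]]]; last first.
  exists (valL_ (mu : A_ nat) f); split; first exact/subspace_valL_continuousP'.
  move=> x y /[!inE] Sx Sy.
  have E z (Sz : S z) : valL_ (mu : A_ nat) f z = f (exist _ z (mem_set Sz)).
    exact: (congr1 (fun k => k (exist _ z (mem_set Sz))) (valLK mu f)).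
  by rewrite (E x Sx) (E y Sy) => /(can_inj fK)/(congr1 val).
have /countable_injP[i ii] := finite_set_countable fS.
exists (Some \o i); split; last by move=> x y Sx Sy /= [] /ii; exact.
apply/within_nearP => x Sx V /nbhs_singleton Vx.
have cSx : closed (S `\ x).
  by apply: compact_closed => //; apply/finite_compact/finite_setD.
have : nbhs x (~` (S `\ x)).
  by apply: open_nbhs_nbhs; split; [exact: closed_openC|move=> [_]; apply].
apply: filterS => y nSy Sy.
by have [->//|yx] := pselect (y = x); exfalso; apply: nSy.
Qed.

End FinOrSeq.

(** * The space Z(X, Y) *)

Section QuotN.
Context {X Y : topologicalType} {D : choiceType}.
Hypothesis cX : compact [set: X].
Hypothesis hX : hausdorff_space X.
Hypothesis cY : compact [set: Y].
Hypothesis hY : hausdorff_space Y.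
Local Notation P := (A_ D * X * Y)%type.
Local Notation N := (@quotN X Y D).
Local Notation pi1 := (@Defs.pi1 X Y D).
Implicit Types (p q : P) (n : N).

(** [level] and [point_X] are unaffected by the collapse. The third coordinate
survives only away from the level [mu]; restricted to one isolated level [d]
and completed by a constant it becomes the continuous map [point_Y y0 d]. *)
Definition level n : A_ D := (repr n).1.1.
Definition point_X n : X := (repr n).1.2.
Definition point_Y (y0 : Y) (d : D) n : Y :=
  if pselect (level n = Some d) then (repr n).2 else y0.

Lemma pi1_continuous : continuous pi1.
Proof. exact: pi_continuous. Qed.

Lemma pi1_eqP p q : pi1 p = pi1 q <-> collapse_rel p q.
Proof. by split => [/eqquotP|?]; last apply/eqquotP. Qed.

Lemma repr_pi1 p : collapse_rel (repr (pi1 p)) p.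
Proof. by apply/pi1_eqP; rewrite /pi1 reprK. Qed.

Lemma pi1_repr n : pi1 (repr n) = n.
Proof. exact: reprK. Qed.

Lemma level_pi1 p : level (pi1 p) = p.1.1.
Proof. by rewrite /level; have /asboolP[->|[-> ->]] := repr_pi1 p. Qed.

Lemma point_X_pi1 p : point_X (pi1 p) = p.1.2.
Proof. by rewrite /point_X; have /asboolP[->|[_ _]] := repr_pi1 p. Qed.

Lemma point_Y_pi1 y0 d p :
  point_Y y0 d (pi1 p) = if pselect (p.1.1 = Some d) then p.2 else y0.
Proof.
rewrite /point_Y level_pi1; case: pselect => //= pd.
by have /asboolP[->|[_ /=]] // := repr_pi1 p; move: (pd) => /= ->.
Qed.

Lemma pi1_level n y0 d : level n = Some d ->
  n = pi1 (Some d, point_X n, point_Y y0 d n).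
Proof.
move=> nd; rewrite -[LHS]pi1_repr /point_Y nd; case: pselect => //= _.
by rewrite -nd /level /point_X -!surjective_pairing.
Qed.

Lemma pi1_mu n y : level n = mu -> n = pi1 (mu, point_X n, y).
Proof.
by move=> nmu; rewrite -[LHS]pi1_repr; apply/pi1_eqP/asboolP; right.
Qed.

Lemma level_continuous : continuous level.
Proof.
apply/quotient_continuous => p.
have -> : level \o \pi_N = fst \o fst by apply/funext => q; exact: level_pi1.
by apply: continuous_comp; exact: cvg_fst.
Qed.

Lemma point_X_continuous : continuous point_X.
Proof.
apply/quotient_continuous => p.
have -> : point_X \o \pi_N = snd \o fst.
  by apply/funext => q; exact: point_X_pi1.
by apply: continuous_comp; [exact: cvg_fst|exact: cvg_snd].
Qed.

Lemma point_Y_continuous y0 d : continuous (point_Y y0 d).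
Proof.
apply/quotient_continuous.
have -> : point_Y y0 d \o \pi_N =
    (fun p => if pselect (p.1.1 = Some d) then p.2 else y0).
  by apply/funext => q; exact: point_Y_pi1.
have lvl : continuous (fun p : P => p.1.1).
  by move=> q; apply: (@continuous_comp _ _ _ fst fst); exact: cvg_fst.
have oS : open [set Some d : A_ D] by exact: A_isolated.
have cS : closed [set Some d : A_ D].
  by apply: compact_closed; [exact: A_hausdorff|exact: compact_set1].
move=> p; have [pd|pd] := pselect (p.1.1 = Some d).
  apply: (@continuous_at_near_eq _ _ snd); last exact: cvg_snd.
  have : nbhs p ((fun p : P => p.1.1) @^-1` [set Some d]).
    by apply: open_nbhs_nbhs; split => //; exact: preimage_open.
  by apply: filterS => q qd; case: pselect.
apply: (@continuous_at_near_eq _ _ (cst y0)); last exact: cst_continuous.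
have : nbhs p ((fun p : P => p.1.1) @^-1` (~` [set Some d])).
  by apply: open_nbhs_nbhs; split => //; apply: preimage_open => //;
    exact: closed_openC.
by apply: filterS => q qd; case: pselect.
Qed.

Lemma quotN_compact : compact [set: N].
Proof.
rewrite (_ : [set: N] = pi1 @` setT).
  apply: continuous_compact; first exact/continuous_subspaceT/pi1_continuous.
  have := compact_setX (compact_setX (@A_compact D) cX) cY.
  by rewrite !setXTT.
by apply/seteqP; split=> // n _; exists (repr n) => //; exact: pi1_repr.
Qed.

(** [level], [point_X] and the maps [point_Y y0 d] together separate points. *)
Lemma quotN_hausdorff : hausdorff_space N.
Proof.
apply: separating_hausdorff => m n mn.
have [lmn|lmn] := pselect (level m = level n); last first.
  exists (A_ D), level; split => //; first exact: A_hausdorff.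
  exact: level_continuous.
have [xmn|xmn] := pselect (point_X m = point_X n); last first.
  by exists X, point_X; split => //; exact: point_X_continuous.
have y0 : Y := (repr m).2.
have [[d md]|lm] : (exists d, level m = Some d) \/ level m = mu.
  by case: (level m) => [d|]; [left; exists d|right].
  exists Y, (point_Y y0 d); split => //.
    exact: point_Y_continuous.
  move=> ymn; apply: mn; rewrite (pi1_level y0 md) xmn ymn -pi1_level//.
  by rewrite -lmn.
exfalso; apply: mn; rewrite (pi1_mu y0 lm) xmn -pi1_mu//.
by rewrite -lmn.
Qed.

Variable phi : D -> set X.
Hypothesis phiP : forall d, fin_or_seq X (phi d).

(** The subset of [quotN] underlying [Zspace]; extension problems are treated
there, in a compact Hausdorff space. *)
Definition Zset : set N := \bigcup_(a in [set: A_ D]) Hset phi a.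

Lemma ZsetE : Zset =
  [set n | forall d, level n = Some d -> phi d (point_X n)].
Proof.
apply/seteqP; split => n.
  move=> [a _ [[[b x] y] /= [[-> ax] _] <-]] d.
  by rewrite level_pi1 point_X_pi1 /= => ad; move: ax; rewrite ad.
move=> /= nphi; exists (level n) => //.
exists (repr n); last exact: pi1_repr.
split => //; split => //=; rewrite -/(point_X n).
by case ln : (level n) => [d|] //=; exact: nphi.
Qed.

Lemma Zset_closed : closed Zset.
Proof.
rewrite ZsetE -[X in closed X]setCK; apply: open_closedC.
rewrite (_ : ~` _ = \bigcup_d (level @^-1` [set Some d] `&`
  point_X @^-1` (~` phi d))).
  apply: bigcup_open => d _; apply: openI; apply: preimage_open.
  - exact: level_continuous.
  - exact: A_isolated.
  - exact: point_X_continuous.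
  - exact: closed_openC (fin_or_seq_closed hX (phiP d)).
apply/seteqP; split => n /=.
  by move=> /existsNP[d /not_implyP[nd nphi]]; exists d.
by move=> [d _ [nd nphi]] /(_ _ nd).
Qed.

Definition slice_X (y : Y) (x : X) : N := pi1 (mu, x, y).
Definition slice_Y (d : D) (x : X) (y : Y) : N := pi1 (Some d, x, y).

Lemma slice_X_continuous y : continuous (slice_X y).
Proof.
move=> x; apply: (@continuous_comp _ _ _ (fun x => (mu : A_ D, x, y)) pi1);
  last exact: pi1_continuous.
by apply: pair_continuous_at; last exact: cvg_cst;
  apply: pair_continuous_at; [exact: cvg_cst|exact: cvg_id].
Qed.

Lemma slice_X_inj y : injective (slice_X y).
Proof. by move=> x x' /(congr1 point_X); rewrite !point_X_pi1. Qed.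

Lemma slice_Y_continuous d x : continuous (slice_Y d x).
Proof.
move=> y; apply: (@continuous_comp _ _ _ (fun y => (Some d : A_ D, x, y)) pi1);
  last exact: pi1_continuous.
by apply: pair_continuous_at; [exact: cvg_cst|exact: cvg_id].
Qed.

Lemma slice_Y_inj d x : injective (slice_Y d x).
Proof.
move=> y y' /(congr1 (point_Y y d)); rewrite !point_Y_pi1/=.
by case: pselect.
Qed.

Lemma fibre_mu (y0 : Y) : Zset `&` level @^-1` [set mu] = range (slice_X y0).
Proof.
rewrite ZsetE; apply/seteqP; split => [n [_ /= nmu]|_ [x _ <-]].
  by exists (point_X n) => //; rewrite /slice_X -pi1_mu.
by split => /=; rewrite level_pi1.
Qed.

Lemma fibre_Some (y0 : Y) d x : phi d x ->
  [set n | level n = Some d /\ point_X n = x] = range (slice_Y d x).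
Proof.
move=> dx; apply/seteqP; split => [n [nd nx]|_ [y _ <-]] /=.
  by exists (point_Y y0 d n) => //; rewrite /slice_Y -nx -pi1_level.
by rewrite level_pi1 point_X_pi1.
Qed.

(** [ext_on_fibres] is applied twice: to [level], whose fibre over [mu] is a
copy of [X], and inside the fibre over [Some d] to a coding [j] of [phi d],
whose fibres are copies of [Y] or empty. *)
Lemma ext_on_Zset (K : topologicalType) (x0 : X) (y0 : Y) :
  nbhd_ext false N K -> nbhd_ext true X K -> nbhd_ext true Y K ->
  ext_on Zset K.
Proof.
move=> eK eX eY; have cN := quotN_compact; have hN := quotN_hausdorff.
have hA := @A_hausdorff D.
have cZ := Zset_closed.
apply: (@ext_on_fibres _ _ _ _ level mu) => //.
- exact/continuous_subspaceT/level_continuous.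
- exact: A_isolated.
move=> a; have [[d ->]|->] : (exists d, a = Some d) \/ a = mu.
- by case: a => [d|]; [left; exists d|right].
- set W := _ `&` _.
  have [j [cj ij]] := fin_or_seq_code hX (phiP d).
  have Wphi n : W n -> phi d (point_X n).
    by move=> [+ nd]; rewrite ZsetE /=; apply.
  apply: (@ext_on_fibres _ _ _ _ (j \o point_X) mu) => //.
  + exact: A_hausdorff.
  + apply: closedI => //; apply: (continuous_closedP level).1.
      exact: level_continuous.
    by apply: compact_closed => //; exact: compact_set1.
  + apply: (within_comp _ _ cj) => //.
    exact/continuous_subspaceT/point_X_continuous.
  + exact: A_isolated.
  move=> b; have [[x [dx xb]]|nb] := pselect (exists x, phi d x /\ j x = b).
    apply: (@ext_on_subset _ _ _ (range (slice_Y d x))).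
      rewrite -(fibre_Some y0 dx) => n [Wn /= nb]; split; first by case: Wn.
      by apply: ij; rewrite ?inE ?nb//; exact: Wphi.
    apply/(ext_on_range y0) => //; first exact: slice_Y_continuous.
    exact: slice_Y_inj.
  apply: (ext_on_subset _ ext_on0) => n [Wn /= nb']; apply: nb.
  by exists (point_X n); split => //; exact: Wphi.
- rewrite (fibre_mu y0); apply/(ext_on_range x0) => //.
    exact: slice_X_continuous.
  exact: slice_X_inj.
Qed.

(** A point of some [phi d] is required in order to find a copy of [Y] in
Z(X, Y). *)
Lemma nbhd_ext_Zspace (K : topologicalType) (x0 : X) (y0 : Y) :
  nbhd_ext false N K -> (exists d x, phi d x) ->
  nbhd_ext true (Zspace Y phi) K <-> nbhd_ext true X K /\ nbhd_ext true Y K.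
Proof.
move=> eK [d [x dx]]; have cN := quotN_compact; have hN := quotN_hausdorff.
have cZ := Zset_closed.
pose i : Zspace Y phi -> N := val.
have i_range : range i = Zset.
  apply/seteqP; split => [_ [z _ <-]|n Zn]; first exact: set_valP.
  by exists (exist _ n (mem_set Zn)).
have Zx : Zset (slice_X y0 x0).
  by rewrite ZsetE /= level_pi1.
have eZ : nbhd_ext true (Zspace Y phi) K <-> ext_on Zset K.
  rewrite -i_range.
  have z0 : Zspace Y phi :=
    exist (fun n => n \in Zset) _ (mem_set Zx).
  apply: (@ext_on_range _ _ K i z0) => //.
  - by apply: set_type_compact; exact: subclosed_compact cZ cN _.
  - exact: initial_continuous.
rewrite eZ; split => [eZs|[eX eY]]; last exact: ext_on_Zset.
split.
- apply/(ext_on_range x0 cX hN (@slice_X_continuous y0) (@slice_X_inj y0)).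
  by apply: ext_on_subset eZs; rewrite -(fibre_mu y0) => n [].
- apply/(ext_on_range y0 cY hN (@slice_Y_continuous d x) (@slice_Y_inj d x)).
  apply: ext_on_subset eZs; rewrite -(fibre_Some y0 dx) ZsetE => n /= [nd nx].
  by move=> d'; rewrite nd => -[<-]; rewrite nx.
Qed.

End QuotN.

(** * Dimension *)

Lemma Ldim_leP {R : realType} (L X : topologicalType) n : [set: L] !=set0 ->
  Ldim_le R L X n <-> nbhd_ext true X (join_powS R L n).
Proof.
move=> [l0 _]; rewrite nbhd_ext_true.
have j0 : join_powS R L n.
  by elim: n => [//|n IH]; exact: (mkjoin IH l0 0).
split=> xL F f cF.
- move=> _ /subspace_sigL_continuousP cf.
  have [g cg gf] := xL F (sigL F f) cF cf.
  exists g; first exact: continuous_subspaceT.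
  by move=> x Fx; rewrite (gf (exist _ x (mem_set Fx))).
- move=> cf.
  have /subspace_valL_continuousP' cvf := cf.
  have [//|g cg gf] := xL F (valL_ j0 f) cF _ (cvf j0).
  exists g => [x|x]; first exact: ((within_openP g openT).1 cg x I).
  rewrite gf; last exact: set_valP.
  by rewrite -[RHS](congr1 (fun k => k x) (valLK j0 f)).
Qed.

(** [Ldim_spec P v] says that [v] is the threshold above which [P] holds.  This
determines [v], and conjunction of properties corresponds to the maximum. *)
Variant Ldim_spec (P : nat -> Prop) : \bar int -> Prop :=
  | LdimFin m of (forall n, P n <-> (m <= n)%N) : Ldim_spec P (m%:Z)%:E
  | LdimInfty of (forall n, ~ P n) : Ldim_spec P +oo%E.

Lemma LdimP {R : realType} (L X : topologicalType) :
  [set: X] !=set0 ->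
  (forall m n, (m <= n)%N -> Ldim_le R L X m -> Ldim_le R L X n) ->
  Ldim_spec (Ldim_le R L X) (Ldim R L X).
Proof.
move=> /set0P/eqP X0 mono; rewrite /Ldim; case: pselect => //= _.
case: pselect => [e|ne] /=; last first.
  by apply: LdimInfty => n Pn; apply: ne; exists n; apply/asboolP.
case: ex_minnP => m /asboolP Pm mP; apply: LdimFin => n; split.
  by move=> Pn; apply: mP; apply/asboolP.
by move=> mn; exact: mono Pm.
Qed.

Lemma Ldim_spec_unique (P : nat -> Prop) u v :
  Ldim_spec P u -> Ldim_spec P v -> u = v.
Proof.
move=> [m mP|nP] [k kP|nP'] //.
- by congr (_%:Z)%:E; apply/eqP; rewrite eqn_leq; apply/andP; split;
    [apply/mP/kP|apply/kP/mP].
- by have /nP' := (mP m).2 (leqnn m).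
- by have /nP := (kP k).2 (leqnn k).
Qed.

Lemma Ldim_spec_and (P Q : nat -> Prop) u v :
  Ldim_spec P u -> Ldim_spec Q v ->
  Ldim_spec (fun n => P n /\ Q n) (maxe u v).
Proof.
move=> [m mP|nP] [k kQ|nQ].
- have -> : maxe (m%:Z)%:E (k%:Z)%:E = ((maxn m k)%:Z)%:E.
    case: (leqP m k) => mk; last move/ltnW: mk => mk.
      by apply/max_idPr; rewrite lee_fin lez_nat.
    by apply/max_idPl; rewrite lee_fin lez_nat.
  by apply: LdimFin => n; rewrite mP kQ geq_max; split => [[-> ->]|/andP].
- by rewrite maxey; apply: LdimInfty => n [_ /nQ].
- by rewrite maxye; apply: LdimInfty => n [/nP].
- by rewrite maxye; apply: LdimInfty => n [/nP].
Qed.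

Theorem lemma3p2 (R : realType) (L : metricType R) (X Y : topologicalType)
    (D : choiceType) (phi : D -> set X) :
  [set: L] !=set0 -> compact [set: L] -> ANR R L -> ~ contractible R L ->
  [set: X] !=set0 -> compact [set: X] -> hausdorff_space X ->
  [set: Y] !=set0 -> compact [set: Y] -> hausdorff_space Y ->
  infinite_set [set: D] ->
  weight_succ_le X [set: D] ->
  weight_succ_le Y [set: D] ->
  fin_or_seq X #<= [set: D] ->
  (forall d, fin_or_seq X (phi d)) ->
  (forall S, fin_or_seq X S -> phi @^-1` [set S] #= [set: D]) ->
  Ldim R L (Zspace Y phi) = maxe (Ldim R L X) (Ldim R L Y).
Proof.
move=> L0 cL anrL _ X0 cX hX Y0 cY hY infD _ _ _ phiP phi_eq.
have [x0 _] := X0; have [y0 _] := Y0.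
have mono (T : topologicalType) (cT : compact [set: T])
    (hT : hausdorff_space T) m n : (m <= n)%N ->
    Ldim_le R L T m -> Ldim_le R L T n.
  rewrite !Ldim_leP//; apply: nbhd_ext_join_powS_mono => //.
    exact: compact_normal.
  exact: ANR_nbhd_ext.
have cN := @quotN_compact X Y D cX cY; have hN := @quotN_hausdorff X Y D hX hY.
have [d pd] : exists d, phi d = [set x0].
  have := phi_eq [set x0] (or_introl (finite_set1 x0)).
  have [[d pd]|] := pselect (phi @^-1` [set [set x0]] !=set0).
    by exists d.
  move=> /set0P/negP; rewrite negbK => /eqP ->.
  by rewrite card_eq_sym card_eq0 => /eqP D0; case: infD; rewrite D0.
have Zle n : Ldim_le R L (Zspace Y phi) n <->
    Ldim_le R L X n /\ Ldim_le R L Y n.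
  rewrite !Ldim_leP//; apply: nbhd_ext_Zspace => //.
    apply: nbhd_ext_join_powS => //; first exact: compact_normal.
    exact: ANR_nbhd_ext.
  by exists d, x0; rewrite pd.
have Z0 : [set: Zspace Y phi] !=set0.
  suff Zx : Zset phi (slice_X y0 x0).
    by exists (exist (fun n => n \in Zset phi) _ (mem_set Zx)).
  by rewrite ZsetE /= level_pi1.
have ZS : Ldim_spec (Ldim_le R L (Zspace Y phi)) (Ldim R L (Zspace Y phi)).
  apply: LdimP => // m n mn; rewrite !Zle => -[Xm Ym].
  by split; [exact: mono Xm|exact: mono Ym].
apply: (Ldim_spec_unique ZS).
rewrite (_ : Ldim_le R L _ = fun n => Ldim_le R L X n /\ Ldim_le R L Y n).
  by apply: Ldim_spec_and; apply: LdimP => //; exact: mono.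
by apply/funext => n; exact/propext/Zle.
Qed.
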